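(* For each positive integer $f$ let $N(f)$ be the number of numerical semigroups with Frobenius number $f$. Then, as $f\to\infty$, the average value of the genus among numerical semigroups with Frobenius number $f$ satisfies $$\frac{1}{N(f)}\sum_{S:\, f(S)=f} g(S)=\frac{3f}{4}+o(f),$$ where the sum is over all numerical semigroups $S$ with Frobenius number $f$.
   Context: A numerical semigroup is a subset $S\subseteq\mathbb{N}=\{0,1,2,\dots\}$ that contains $0$, is closed under addition, and has finite complement in $\mathbb{N}$. The genus $g(S)$ is the number of elements of $\mathbb{N}\setminus S$ (the gaps of $S$). The Frobenius number $f(S)$ is the largest element of $\mathbb{N}\setminus S$. For a given positive integer $f$ there are only finitely many numerical semigroups with Frobenius number $f$. *)

(* Defs.v *)
From HB Require Import structures.
From mathcomp Require Import all_boot all_order all_algebra finmap.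
From mathcomp Require Import all_classical all_reals all_analysis.

Set Implicit Arguments.
Unset Strict Implicit.
Unset Printing Implicit Defensive.

Import Order.TTheory GRing.Theory Num.Theory.

Local Open Scope classical_set_scope.

Record numerical_semigroup (S : set nat) : Prop := NumericalSemigroup {
  numerical_semigroup0 : S 0;
  numerical_semigroupD : forall m n, S m -> S n -> S (m + n);
  numerical_semigroup_cofinite : finite_set (~` S) }.

Definition genus (S : set nat) : nat := #|` fset_set (~` S)|.

(* A relation rather than a function, because [setT] has no gaps. *)
Definition frobenius_number (S : set nat) (f : nat) : Prop :=
  ~ S f /\ forall n, ~ S n -> n <= f.

Definition semigroups_of_frobenius (f : nat) : set (set nat) :=
  [set S | numerical_semigroup S /\ frobenius_number S f].

(* [fset_set] and sums over [\in] are only meaningful on finite sets. *)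
Lemma finite_semigroups_of_frobenius f :
  finite_set (semigroups_of_frobenius f).
Proof.
pose h (B : {set 'I_f.+1}) : set nat :=
  [set n | forall i : 'I_f.+1, i = n :> nat -> i \in B].
apply: (@sub_finite_set _ _ (h @` setT)); last exact/finite_image/finite_finset.
move=> S [_ [_ ub]]; exists [set i : 'I_f.+1 | `[< S i >]]%SET => //.
apply/seteqP; split => n /=; last by move=> Sn i en; rewrite inE en; apply/asboolP.
move=> hn; apply: contrapT => nSn.
have ltn : n < f.+1 by rewrite ltnS ub.
by have := hn (Ordinal ltn) erefl; rewrite inE => /asboolP.
Qed.

Definition num_semigroups_of_frobenius (f : nat) : nat :=
  #|` fset_set (semigroups_of_frobenius f)|.

Definition average_genus (R : realType) (f : nat) : R :=
  ((num_semigroups_of_frobenius f)%:R^-1 *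
   \sum_(S \in semigroups_of_frobenius f) ((genus S)%:R : R))%R.

(* Main.v *)
Require Import Defs.
From mathcomp Require Import all_boot all_order all_algebra.
From mathcomp Require Import all_classical all_reals all_analysis.
From mathcomp Require Import finmap fintype finset zify ring lra.

(** A semigroup with Frobenius number f contains at most one element of each pair {x, f -
x}, and all subsets of (f/2, f) occur, so there are at least 2^((f-1)/2) semigroups. Those
whose multiplicity m is at least f/2 - o(f) are determined, up to 2^o(f) choices, by an
arbitrary subset of (f/2, f), which by a Chernoff bound almost always has about f/4
elements; this gives genus about 3f/4.

The semigroups with m < f/2 - cf are exponentially rarer than 2^(f/2). The residue classes
of i and f - i modulo m, with K terms each, meet S in an upper and a lower segment which
are disjoint and not full: C(K+2,2) - 2 possibilities, which is 2^K for K = 2, 3 and at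
most 1.93^K for K >= 4. So there is a gain unless almost all classes have at most 3 terms.
In that case put R = f - 2m and look for u with m + u in S and 2R/5 <= u < R/2. If there
is none, the pairs of classes of such u have 6 patterns instead of 8. If there is one,
then m + x in S implies 2m + x + u in S, and the two pairs of classes of x and R - u - x
have 53 joint patterns instead of 64. *)

Set Implicit Arguments.
Unset Strict Implicit.
Unset Printing Implicit Defensive.

Import Order.TTheory GRing.Theory Num.Theory.
Import numFieldNormedType.Exports.

(** * Traces of families of subsets of [0, f) *)

Lemma leq_card_imset_factor (T X Y : finType) (g : T -> X) (h : T -> Y)
    (F : {set T}) :
  {in F &, forall A B, g A = g B -> h A = h B} ->
  #|h @: F| <= #|g @: F|.
Proof.
move=> gh; pose pre x := [pick A in F | g A == x].
pose k x := omap h (pre x).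
have -> : #|h @: F| = #|Some @: (h @: F)|.
  by rewrite [RHS]card_imset // => x y [].
suff -> : Some @: (h @: F) = k @: (g @: F) by exact: leq_imset_card.
rewrite -!imset_comp; apply: eq_in_imset => A AF /=; rewrite /k /pre.
case: pickP => [B /andP[BF /eqP gB]|/(_ A)]; last by rewrite AF eqxx.
by rewrite /= (gh _ _ BF AF gB).
Qed.

Section Trace.
Variable f : nat.
Implicit Types (A B : f.-tuple bool) (F : {set f.-tuple bool}) (s t : seq nat).

Definition restriction s A : (size s).-tuple bool :=
  map_tuple (nth false A) (in_tuple s).

Definition ntraces F s := #|restriction s @: F|.

Lemma restriction_eqP s A B :
  reflect {in s, nth false A =1 nth false B} (restriction s A == restriction s B).
Proof.
apply: (iffP eqP) => [/(congr1 val)/= /eq_in_map //|h].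
by apply/val_inj/eq_in_map.
Qed.

Lemma ntraces_le_card (X : finType) (g : f.-tuple bool -> X) (P : {set X}) F s :
  (forall A, A \in F -> g A \in P) ->
  {in F &, forall A B, g A = g B -> {in s, nth false A =1 nth false B}} ->
  ntraces F s <= #|P|.
Proof.
move=> gP gs; apply: (@leq_trans #|g @: F|).
  by apply: leq_card_imset_factor => A B AF BF /gs e; apply/eqP/restriction_eqP/e.
by apply/subset_leq_card/subsetP => _ /imsetP[A AF ->]; exact: gP.
Qed.

Lemma ntraces_determined F s t :
  {in F &, forall A B, {in t, nth false A =1 nth false B} ->
                       {in s, nth false A =1 nth false B}} ->
  ntraces F s <= ntraces F t.
Proof.
move=> ts; apply: (@ntraces_le_card _ (restriction t)) => [A|A B AF BF /eqP/restriction_eqP].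
  exact: imset_f.
exact: ts.
Qed.

Lemma ntraces_sub F F' s : F \subset F' -> ntraces F s <= ntraces F' s.
Proof. by move=> FF'; apply/subset_leq_card/imsetS. Qed.

Lemma card_le_ntraces F s :
  {in F &, forall A B, {in s, nth false A =1 nth false B} ->
                       forall n, n < f -> nth false A n = nth false B n} ->
  #|F| <= ntraces F s.
Proof.
move=> sF; rewrite -[leqLHS](card_in_imset (f := id)); last by move=> ? ?.
apply: leq_card_imset_factor => A B AF BF /eqP/restriction_eqP/(sF _ _ AF BF) AB.
by apply/val_inj/(@eq_from_nth _ false) => [|i]; rewrite !size_tuple //; exact: AB.
Qed.

Lemma ntraces_cat F s t : ntraces F (s ++ t) <= ntraces F s * ntraces F t.
Proof.
rewrite -cardsX; apply: (@ntraces_le_card _ (fun A => (restriction s A, restriction t A))).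
  by move=> A AF; rewrite inE /= !imset_f.
move=> A B AF BF [] /eqP/restriction_eqP hs /eqP/restriction_eqP ht n.
by rewrite mem_cat => /orP[/hs|/ht].
Qed.

Lemma ntraces_flatten F (ss : seq (seq nat)) :
  ntraces F (flatten ss) <= \prod_(s <- ss) ntraces F s.
Proof.
elim: ss => [|s ss ih] /=.
  by rewrite big_nil (leq_trans (max_card _)) // card_tuple.
by rewrite big_cons (leq_trans (ntraces_cat _ _ _)) // leq_mul2l ih orbT.
Qed.

(** An explicit list, so that counts of short bit strings can be evaluated by computation. *)
Fixpoint bitseqs n : seq bitseq :=
  if n is n'.+1 then map (cons true) (bitseqs n') ++ map (cons false) (bitseqs n')
  else [:: [::]].

Lemma mem_bitseqs (b : bitseq) : b \in bitseqs (size b).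
Proof.
elim: b => //= x b ih; rewrite mem_cat; case: x; apply/orP; [left|right];
by apply: map_f.
Qed.

Lemma ntraces_bits F s (P : pred bitseq) :
  (forall A, A \in F -> P (map (nth false A) s)) ->
  ntraces F s <= count P (bitseqs (size s)).
Proof.
move=> FP; rewrite -size_filter /ntraces cardE -(size_map val).
apply: uniq_leq_size => [|_ /mapP[b + ->]].
  by rewrite map_inj_uniq ?enum_uniq //; exact: val_inj.
rewrite mem_enum => /imsetP[A AF ->].
have := mem_bitseqs (map (nth false A) s); rewrite size_map => bs.
by rewrite mem_filter /= FP.
Qed.

End Trace.

(** * Semigroups of given multiplicity *)

Section Family.
Variable f : nat.
Implicit Types (A B : f.-tuple bool) (F : {set f.-tuple bool}) (s t : seq nat).

(* [A] lists the membership in [S] of [0, ..., f - 1], for [S] with Frobenius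
   number [f]; everything above [f] is in [S]. *)
Definition truncated_semigroup A : bool :=
  nth false A 0 && [forall x : 'I_f, forall y : 'I_f,
    nth false A x && nth false A y ==>
    (x + y != f) && ((x + y < f) ==> nth false A (x + y))].

Lemma nth_lt A n : nth false A n -> n < f.
Proof. by apply: contraTT; rewrite -leqNgt => fn; rewrite nth_default ?size_tuple. Qed.

Lemma truncated_semigroupD A x y : truncated_semigroup A ->
  nth false A x -> nth false A y -> x + y < f -> nth false A (x + y).
Proof.
move=> /andP[_ /forallP h] Ax Ay.
have /forallP/(_ (Ordinal (nth_lt Ay)))/= := h (Ordinal (nth_lt Ax)).
by rewrite Ax Ay /= => /andP[_ /implyP].
Qed.

Lemma truncated_semigroupN A x y : truncated_semigroup A ->
  nth false A x -> nth false A y -> x + y = f -> False.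
Proof.
move=> /andP[_ /forallP h] Ax Ay.
have /forallP/(_ (Ordinal (nth_lt Ay)))/= := h (Ordinal (nth_lt Ax)).
by rewrite Ax Ay /= => /andP[/eqP].
Qed.

Definition sgs : {set f.-tuple bool} := [set A | truncated_semigroup A].

Definition sgs_mult m : {set f.-tuple bool} :=
  [set A in sgs | nth false A m & all (fun x => ~~ nth false A x) (iota 1 m.-1)].

Section Mult.
Variables (m : nat) (m0 : 0 < m).

Lemma sgs_multD A x k : A \in sgs_mult m -> nth false A x -> x + k * m < f ->
  nth false A (x + k * m).
Proof.
rewrite !inE => /and3P[AS Am _] Ax; elim: k => [|k ih]; first by rewrite addn0.
move=> xk; have := truncated_semigroupD AS (ih _) Am.
by rewrite -addnA -mulSnr; apply=> //; lia.
Qed.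

(** Adding the [k] copies of [m] would produce [f]. As [A] stops below [f], one copy goes to [x] and
    the others to [y], and closure is used below [f] only. *)
Lemma sgs_mult_frobenius A x y k : A \in sgs_mult m -> nth false A x -> nth false A y ->
  x + y + k * m = f -> False.
Proof.
move=> AF Ax Ay; case: k => [|k] e.
  move: AF; rewrite inE => /andP[]; rewrite inE => /truncated_semigroupN AS _.
  by apply: AS Ax Ay _; lia.
have Ay' : nth false A (y + k * m) by apply: sgs_multD => //; lia.
have := AF; rewrite !inE => /and3P[AS Am _].
(* If [x + m] is not below [f], it equals [f]. *)
have [xm|xm] := ltnP (x + m) f; last by apply: (truncated_semigroupN AS Ax Am); lia.
by apply: (truncated_semigroupN AS (truncated_semigroupD AS Ax Am xm) Ay'); lia.
Qed.

Lemma sgs_mult_gap A x : A \in sgs_mult m -> 0 < x < m -> nth false A x = false.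
Proof.
rewrite !inE => /and3P[_ _ /allP h] xm; apply/negbTE/h; rewrite mem_iota; lia.
Qed.

Lemma sgs_mult_sgs A : A \in sgs_mult m -> A \in sgs.
Proof. by rewrite inE => /andP[]. Qed.

Lemma sgs_mult_mem A : A \in sgs_mult m -> nth false A m.
Proof. by rewrite inE => /and3P[]. Qed.

Lemma sgs_mult0 A : A \in sgs_mult m -> nth false A 0.
Proof. by rewrite !inE => /andP[/andP[]]. Qed.

(** For the right [K], all numbers below [f] in the classes of [i] and of [f - i] modulo [m],
    indexed so that equal [j] gives two numbers with sum [f]. *)
Definition class_pair K i : seq nat :=
  [seq i + j * m | j <- iota 0 K] ++ [seq f - (i + j * m) | j <- iota 0 K].

Definition npairs K := 'C(K.+2, 2) - 2.

Lemma card_triangle K : #|[set p : 'I_K.+1 * 'I_K.+1 | p.2 <= p.1]| = 'C(K.+2, 2).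
Proof.
rewrite -bin2_sum big_mkord big_ord_recl add0n /=.
rewrite -sum1dep_card -(pair_big_dep xpredT (fun i j : 'I_K.+1 => j <= i) (fun _ _ => 1)) /=.
apply: eq_bigr => i _.
rewrite (eq_bigl (fun j : 'I_K.+1 => j < i.+1)) // (big_ord_narrow (ltn_ord i)).
by rewrite sum1_card card_ord.
Qed.

(* In terms of the index [j] of [class_pair], [S] meets the class of [i] in an
   upper segment and that of [f - i] in a lower one; they are disjoint, and
   neither is full because [i < m] and the last [f - (i + j * m)] is [< m]. *)
Lemma ntraces_class_pair K i : 1 < K -> 0 < i < m -> i + K.-1 * m < f < i + K * m ->
  ntraces (sgs_mult m) (class_pair K i) <= npairs K.
Proof.
move=> K1 im fK.
(* [find] returns [K] when nothing is found: [low A = K] if [S] misses the class of [i], and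
   [up A = K] if [S] contains all listed terms of the other class. *)
pose low A := find (fun j => nth false A (i + j * m)) (iota 0 K).
pose up A := find (fun j => ~~ nth false A (f - (i + j * m))) (iota 0 K).
have lowK A : low A <= K by rewrite -[leqRHS](size_iota 0) find_size.
have upK A : up A <= K by rewrite -[leqRHS](size_iota 0) find_size.
have lowP A j : A \in sgs_mult m -> j < K -> nth false A (i + j * m) = (low A <= j).
  move=> AF jK; apply/idP/idP => [h|lj].
    rewrite leqNgt; apply/negP => /(before_find 0).
    by rewrite nth_iota // add0n h.
  have hl : has (fun j => nth false A (i + j * m)) (iota 0 K).
    by rewrite has_find size_iota; apply: leq_ltn_trans jK.
  have := nth_find 0 hl; rewrite -/(low A) nth_iota ?add0n; last lia.
  move=> /(@sgs_multD _ _ (j - low A) AF); rewrite -addnA -mulnDl subnKC //; apply.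
  have : j * m <= K.-1 * m by rewrite leq_mul2r; lia.
  lia.
have jf j : j < K -> i + j * m < f.
  move=> jK; have : j * m <= K.-1 * m by rewrite leq_mul2r; lia.
  lia.
have upP A j : A \in sgs_mult m -> j < K -> nth false A (f - (i + j * m)) = (j < up A).
  move=> AF jK; apply/idP/idP => [h|lj]; last first.
    by have /negbFE := before_find 0 lj; rewrite nth_iota ?add0n.
  rewrite ltnNge; apply/negP => lj.
  have hl : has (fun j => ~~ nth false A (f - (i + j * m))) (iota 0 K).
    by rewrite has_find size_iota; apply: leq_ltn_trans jK.
  have /negP := nth_find 0 hl; rewrite -/(up A) nth_iota ?add0n; last lia.
  apply; have e : f - (i + up A * m) = f - (i + j * m) + (j - up A) * m.
    have : j * m = up A * m + (j - up A) * m by rewrite -mulnDl subnKC.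
    by have := jf _ jK; move: (j * m) (up A * m) ((j - up A) * m); lia.
  by rewrite e; apply: sgs_multD => //; rewrite -e; have := jf 0; lia.
(* Since [up <= low], a full class of [i] ([low = 0]) or of [f - i] ([up = K]) can only occur at one
   of the two removed corners. *)
pose P := [set p : 'I_K.+1 * 'I_K.+1 | p.2 <= p.1] :\ (ord0, ord0) :\ (ord_max, ord_max).
have -> : npairs K = #|P|.
  rewrite /npairs -card_triangle.
  rewrite (cardsD1 (ord0, ord0)) [in LHS](cardsD1 (ord_max, ord_max)) !inE /= leqnn /=.
  have -> : ((ord_max, ord_max) == (ord0, ord0) :> 'I_K.+1 * 'I_K.+1) = false.
    by apply/negbTE/eqP => -[]; lia.
  by rewrite -/P; lia.
apply: (@ntraces_le_card _ _ (fun A => (inord (low A), inord (up A)) : 'I_K.+1 * 'I_K.+1)).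
  move=> A AF; rewrite !inE /= !xpair_eqE -!val_eqE /= !inordK ?ltnS //.
  apply/and3P; split.
  - apply/negP => /andP[_ /eqP uK].
    have := upP A K.-1 AF; rewrite uK (@sgs_mult_gap A) //; first by lia.
    have : K * m = K.-1 * m + m by rewrite -mulSnr prednK //; lia.
    lia.
  - apply/negP => /andP[/eqP l0 _].
    by have := lowP A 0 AF; rewrite l0 addn0 (@sgs_mult_gap A) //; lia.
  - rewrite leqNgt; apply/negP => lu.
    have h1 : nth false A (i + low A * m) by rewrite lowP //; apply: leq_trans lu _.
    have lK : low A < K by apply: leq_trans lu _.
    have h2 : nth false A (f - (i + low A * m)) by rewrite upP.
    by apply: (@sgs_mult_frobenius A _ _ 0 AF h1 h2); have := jf _ lK; lia.
move=> A B AF BF /(congr1 (fun p => (val p.1, val p.2)))[] /=.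
rewrite !inordK ?ltnS // => el eu n; rewrite mem_cat.
by case/orP => /mapP[j]; rewrite mem_iota add0n /= => jK ->; rewrite ?lowP ?upP ?el ?eu.
Qed.

End Mult.
End Family.

Lemma prod_eq_const (T : eqType) (s : seq T) (F : T -> nat) c :
  {in s, forall i, F i = c} -> \prod_(i <- s) F i = c ^ size s.
Proof.
by move=> Fc; rewrite (eq_big_seq (fun=> c)) // big_const_seq count_predT iter_muln_1.
Qed.

(** * Pairs of residue classes modulo [m], where [f = q * m + r] *)

Section Cover.
Variables (f m q r : nat).
Hypotheses (r0 : 0 < r) (rm : r < m) (q2 : 1 < q) (fqr : f = q * m + r).
Implicit Types (A B : f.-tuple bool) (F : {set f.-tuple bool}) (s t : seq nat).

Let m0 : 0 < m. Proof. by lia. Qed.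

Definition class_size i := if i < r then q.+1 else q.
Definition pair_of i := class_pair f m (class_size i) i.
(* One residue out of each pair [{i, f - i}] modulo [m] other than [{0, r}]. *)
Definition reps := iota 1 (r %/ 2) ++ [seq r + k | k <- iota 1 ((m - r) %/ 2)].
Definition pairs_bound := \prod_(i <- reps) npairs (class_size i).

Lemma class_sizeP i : 0 < i < m -> i != r ->
  i + (class_size i).-1 * m < f < i + class_size i * m.
Proof.
move=> im ir; rewrite /class_size; case: (ltnP i r) => ri /=; rewrite fqr ?mulSn; first lia.
have : q * m = m + q.-1 * m by rewrite -mulSn prednK //; lia.
lia.
Qed.

Lemma mem_reps i : (i \in reps) = (0 < i) && (2 * i <= r) || (r < i) && (2 * i <= m + r).
Proof.
clear m0 r0 rm q2 fqr; rewrite mem_cat mem_iota; congr (_ || _); first lia.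
apply/mapP/idP => [[k]|h]; first by rewrite mem_iota; lia.
by exists (i - r); rewrite ?mem_iota; lia.
Qed.

Lemma reps_uniq : uniq reps.
Proof.
rewrite cat_uniq iota_uniq map_inj_uniq ?iota_uniq ?andbT /=; last exact: addnI.
by apply/hasPn => x /mapP[k]; rewrite mem_iota /= mem_iota; lia.
Qed.

Lemma pairs_boundE :
  pairs_bound = npairs q.+1 ^ (r %/ 2) * npairs q ^ ((m - r) %/ 2).
Proof.
clear m0 r0 rm q2 fqr; rewrite /pairs_bound big_cat big_map; congr (_ * _).
  rewrite -[in RHS](size_iota 1 (r %/ 2)); apply: prod_eq_const => i.
  by rewrite mem_iota /class_size => ir; case: (ltnP i r) => //; lia.
rewrite -[in RHS](size_iota 1 ((m - r) %/ 2)); apply: prod_eq_const => i _.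
by rewrite /class_size; case: (ltnP (r + i) r) => //; lia.
Qed.

(** Multiples of [m] belong to [S], and the class of [r], which is that of [f], misses it. Of any
    other class and its partner, at least one has its residue in [reps]. *)
Lemma reps_cover : {in sgs_mult f m &, forall A B,
  {in flatten (map pair_of reps), nth false A =1 nth false B} ->
  forall n, n < f -> nth false A n = nth false B n}.
Proof.
move=> A B AF BF AB n nf.
have nE := divn_eq n m; have im : n %% m < m by rewrite ltn_mod.
move: (n %/ m) (n %% m) nE im => j i nE im.
have [i0|i0] := posnP i.
  have z C : C \in sgs_mult f m -> nth false C n.
    move=> CF; have := @sgs_multD _ _ m0 C 0 j CF (sgs_mult0 CF); rewrite nE i0 addnC.
    by apply; lia.
  by rewrite !z.
have [ir|ir] := eqVneq i r.
  have z C : C \in sgs_mult f m -> nth false C n = false.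
    move=> CF; apply/negP => Cn.
    apply: (@sgs_mult_frobenius _ _ m0 C 0 n (q - j) CF (sgs_mult0 CF) Cn).
    have jq : j <= q by rewrite -(leq_pmul2r m0); lia.
    have : q * m = j * m + (q - j) * m by rewrite -mulnDl subnKC.
    lia.
  by rewrite !z.
apply: AB; apply/flattenP.
have jK : j < class_size i.
  have /andP[_ h] : i + (class_size i).-1 * m < f < i + class_size i * m.
    by apply: class_sizeP => //; rewrite i0.
  by rewrite -(ltn_pmul2r m0); lia.
have [irep|irep] := boolP (i \in reps).
  exists (pair_of i); first exact: map_f.
  rewrite mem_cat; apply/orP; left; apply/mapP; exists j; last lia.
  by rewrite mem_iota.
(* [i'] is the residue of [f - i], and [n = f - (i' + j' * m)] with [j' = (class_size i).-1 - j]. *)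
pose i' := if i < r then r - i else m + r - i.
have i'rep : i' \in reps.
  by move: irep; rewrite !mem_reps /i'; case: (ltnP i r); lia.
have Ki : class_size i' = class_size i.
  by rewrite /class_size /i'; case: (ltnP i r) => ?; case: ltnP => //; lia.
exists (pair_of i'); first exact: map_f.
rewrite mem_cat; apply/orP; right; apply/mapP; rewrite Ki.
exists ((class_size i).-1 - j); first by rewrite mem_iota; lia.
have e : (class_size i).-1 * m = j * m + ((class_size i).-1 - j) * m.
  by rewrite -mulnDl subnKC //; lia.
move: e; rewrite /class_size /i'; case: (ltnP i r) => ri /= e.
  lia.
have : q * m = m + q.-1 * m by rewrite -mulSn prednK //; lia.
move: e; move: ((_ - _) * m) (q * m) (q.-1 * m) (j * m) fqr nE => a b c d *; lia.
Qed.

(** A group of [d] representatives with three-term classes contributes at most [c] instead of the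
    [8 ^ d] contained in [pairs_bound], as [npairs 3 = 8]. The saving [(c / 8 ^ d) ^ size G] is
    written without division. *)
Lemma card_groups F (G : seq (seq nat)) c d : F \subset sgs_mult f m ->
  uniq (flatten G) -> {subset flatten G <= reps} ->
  {in flatten G, forall i, class_size i = 3} ->
  {in G, forall g, size g = d} ->
  {in G, forall g, ntraces F (flatten (map pair_of g)) <= c} ->
  #|F| * (8 ^ d) ^ size G <= c ^ size G * pairs_bound.
Proof.
move=> FF uG subG G3 Gd Gc.
pose Z := [seq i <- reps | i \notin flatten G].
have pe : perm_eq reps (flatten G ++ Z).
  apply: uniq_perm; first exact: reps_uniq.
    rewrite cat_uniq uG filter_uniq ?reps_uniq // andbT /=.
    by apply/hasPn => i; rewrite /Z mem_filter => /andP[].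
  move=> i; rewrite [RHS]mem_cat /Z mem_filter.
  by have [/subG ->|] := boolP (i \in flatten G).
(* Ungrouped representatives become singletons, bounded by [npairs]. *)
pose J := G ++ [seq [:: i] | i <- Z].
have JE : flatten J = flatten G ++ Z.
  by rewrite flatten_cat; congr (_ ++ _); elim: (Z) => //= x s ->.
have FJ : #|F| <= \prod_(g <- J) ntraces F (flatten (map pair_of g)).
  rewrite -(big_map (fun g => flatten (map pair_of g)) predT (ntraces F)).
  apply: leq_trans (ntraces_flatten _ _); apply: card_le_ntraces => A B AF BF AB.
  apply: reps_cover; [exact: (subsetP FF)|exact: (subsetP FF)|].
  move=> n /flattenP[_ /mapP[i ir ->]] ni; apply: AB.
  move: ir; rewrite (perm_mem pe) -JE => /flattenP[g gJ ig].
  apply/flattenP; exists (flatten (map pair_of g)); first exact: map_f.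
  by apply/flattenP; exists (pair_of i) => //; exact: map_f.
have -> : pairs_bound = (8 ^ d) ^ size G * \prod_(i <- Z) npairs (class_size i).
  rewrite /pairs_bound (perm_big _ pe) big_cat; congr (_ * _).
  elim: G G3 Gd {uG subG Gc Z pe J JE FJ} => [|g G ih] G3 Gd; first by rewrite big_nil.
  rewrite /= big_cat expnS ih; last first.
  - by move=> i iG; apply: Gd; rewrite inE iG orbT.
  - by move=> i iG; apply: G3; rewrite /= mem_cat iG orbT.
  congr (_ * _); rewrite -(Gd g (mem_head _ _)); apply: prod_eq_const => i ig.
  by rewrite G3 // mem_cat ig.
rewrite mulnCA mulnC leq_mul2l; apply/orP; right.
apply: leq_trans FJ _; rewrite big_cat big_map leq_mul //.
  elim: G Gc {uG subG G3 Gd Z pe J JE} => [|g G ih] Gc; first by rewrite big_nil.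
  rewrite big_cons expnS leq_mul //; first by apply: Gc; exact: mem_head.
  by apply: ih => i iG; apply: Gc; rewrite inE iG orbT.
rewrite big_seq [leqRHS]big_seq; apply: leq_prod => i.
rewrite /Z mem_filter mem_reps => /andP[_ ir] /=; rewrite cats0.
have im : 0 < i < m by lia.
apply: leq_trans (ntraces_sub _ FF) _; apply: ntraces_class_pair => //.
  by rewrite /class_size; case: ifP; lia.
by apply: class_sizeP => //; lia.
Qed.

Lemma card_sgs_mult F : F \subset sgs_mult f m -> #|F| <= pairs_bound.
Proof. by move/(@card_groups _ [::] 0 0); rewrite muln1 mul1n; apply. Qed.

(** * Pairs of classes with three terms each *)

Section Length3.
Variables (R : nat) (fR : f = R + 2 * m).

(** The least terms [i] and [R - i] of the two classes lie strictly between 0 and [m], hence are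
    gaps; the other four positions form [t]. *)
Lemma pair3_determined i : 0 < i < m -> 0 < R - i < m -> class_size i = 3 ->
  let t := [:: m + i; 2 * m + i; m + (R - i); 2 * m + (R - i)] in
  {in sgs_mult f m &, forall A B, {in t, nth false A =1 nth false B} ->
    {in pair_of i, nth false A =1 nth false B}}.
Proof.
move=> im Rim K3 t A B AF BF AB n.
have small k : 0 < k < m -> nth false A k = nth false B k.
  by move=> km; rewrite !(@sgs_mult_gap f m).
have inT k : k \in t -> nth false A k = nth false B k by exact: AB.
rewrite /pair_of K3 /class_pair /= !inE => /or4P[|||/or3P[]] /eqP ->.
- by apply: small; lia.
- by apply: inT; rewrite !inE; lia.
- by apply: inT; rewrite !inE; lia.
- by apply: inT; rewrite !inE; lia.
- by apply: inT; rewrite !inE; lia.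
- by apply: small; lia.
Qed.

(** Without [m + i] there remain two choices for [2 * m + i] and three nondecreasing patterns on
    [m + (R - i)], [2 * m + (R - i)]. *)
Lemma ntraces_pair_absent F i : F \subset sgs_mult f m ->
  0 < i < m -> 0 < R - i < m -> class_size i = 3 ->
  (forall A, A \in F -> ~~ nth false A (m + i)) ->
  ntraces F (pair_of i) <= 6.
Proof.
move=> FF im Rim K3 abs.
pose t := [:: m + i; 2 * m + i; m + (R - i); 2 * m + (R - i)].
apply: (@leq_trans (ntraces F t)).
  apply: ntraces_determined => A B /(subsetP FF) AF /(subsetP FF) BF.
  exact: pair3_determined.
pose P b := ~~ nth false b 0 && (nth false b 2 ==> nth false b 3).
have -> : 6 = count P (bitseqs (size t)) by vm_compute.
apply: ntraces_bits => A AF; rewrite /P /= (negbTE (abs _ AF)) /=.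
apply/implyP => h; have := @sgs_multD _ _ m0 A _ 1 (subsetP FF _ AF) h.
by rewrite mul1n -addnA (addnC _ m) addnA mul2n addnn; apply; lia.
Qed.

(** Adding [m + u] takes [m + x] to [2 * m + (R - y)] and [m + y] to [2 * m + (R - x)]. Each of
    these implications excludes 6 of the 64 joint patterns, and one pattern violates both: 64 - 6 -
    6 + 1 = 53. *)
Lemma ntraces_pair_shift F u x : F \subset sgs_mult f m ->
  (forall A, A \in F -> nth false A (m + u)) ->
  let y := R - (x + u) in x + u < R ->
  0 < x < m -> 0 < y < m -> x + u < m -> y + u < m ->
  class_size x = 3 -> class_size y = 3 ->
  ntraces F (pair_of x ++ pair_of y) <= 53.
Proof.
move=> FF Fu y xuR xm ym xum yum Kx Ky; have yE : x + u + y = R by rewrite subnKC // ltnW.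
move: y yE ym yum Ky => y yE ym yum Ky.
pose t := [:: m + x; 2 * m + x; m + (R - x); 2 * m + (R - x);
              m + y; 2 * m + y; m + (R - y); 2 * m + (R - y)].
apply: (@leq_trans (ntraces F t)).
  apply: ntraces_determined => A B /(subsetP FF) AF /(subsetP FF) BF AB n.
  rewrite mem_cat => /orP[]; apply: pair3_determined => // [|k kt]; try lia.
    by apply: AB; move: kt; rewrite !inE => /or4P[] ->; rewrite ?orbT.
  by apply: AB; move: kt; rewrite !inE => /or4P[] ->; rewrite ?orbT.
pose P b := [&& nth false b 0 ==> nth false b 1, nth false b 2 ==> nth false b 3,
  nth false b 4 ==> nth false b 5, nth false b 6 ==> nth false b 7,
  ~~ (nth false b 0 && nth false b 2), ~~ (nth false b 4 && nth false b 6),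
  nth false b 0 ==> nth false b 7 & nth false b 4 ==> nth false b 3].
have -> : 53 = count P (bitseqs (size t)) by vm_compute.
apply: ntraces_bits => A AF; rewrite /P /=.
have AM := subsetP FF _ AF.
have sh i : i < R -> nth false A (m + i) -> nth false A (2 * m + i).
  move=> iR h; have := @sgs_multD _ _ m0 A _ 1 AM h.
  by rewrite mul1n -addnA (addnC _ m) addnA mul2n addnn; apply; lia.
have shu i j : i + u = j -> j < R -> nth false A (m + i) -> nth false A (2 * m + j).
  move=> ij iR h; have -> : 2 * m + j = m + i + (m + u) by lia.
  by apply: truncated_semigroupD (Fu _ AF) _ => //; [move: (sgs_mult_sgs AM); rewrite inE|lia].
have ref i j : i + j = R -> ~~ (nth false A (m + i) && nth false A (m + j)).
  move=> ij; apply/negP => /andP[Ai Aj].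
  by apply: (@sgs_mult_frobenius _ _ m0 A _ _ 0 AM Ai Aj); lia.
apply/and5P; split; last apply/and4P; try split; try (apply: ref; lia).
all: apply/implyP; (apply: sh; lia) || (apply: shu; lia).
Qed.

End Length3.
End Cover.

Local Open Scope ring_scope.

Lemma npairsS K : (0 < K)%N -> npairs K.+1 = (npairs K + K.+2)%N.
Proof.
move=> K0; have := binS K.+2 1; have := binS K.+1 1; rewrite /npairs !bin1; lia.
Qed.

(** * Semigroups of small multiplicity *)

Section Weights.
Variable R : realFieldType.

(** An upper bound for [npairs K]: exact for [K = 2, 3], and of base below 2 from [K = 4] on, where
    [npairs 4 = 13 < 1.93 ^ 4]. *)
Definition weight K : R := if (K < 4)%N then 2 ^+ K else (193 / 100) ^+ K.

Lemma weight_ge0 K : 0 <= weight K.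
Proof. by rewrite /weight; case: ifP => _; apply: exprn_ge0; lra. Qed.

Lemma weight_le K : weight K <= 2 ^+ K.
Proof. by rewrite /weight; case: ifP => _ //; apply: lerXn2r; rewrite ?nnegrE; lra. Qed.

Lemma npairs_le_weight K : (1 < K)%N -> (npairs K)%:R <= weight K.
Proof.
case: K => [|[|[|[|K]]]] // _; rewrite /weight /=; try by rewrite -natrX ler_nat.
elim: K => [|K ih]; first by rewrite (_ : npairs 4 = 13%N) //; lra.
(* The next value adds [K + 6], at most half of this lower bound, so the growth factor is at most
   3/2. *)
have low : (2 * K + 12 <= npairs K.+4)%N.
  by elim: (K) => [|k low] //; rewrite npairsS //; lia.
rewrite npairsS // natrD exprS.
have : (2 * K + 12)%:R <= (npairs K.+4)%:R :> R by rewrite ler_nat.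
move: ih; rewrite natrD natrM -[K.+4.+2]/(6 + K)%N !natrD; set p := (npairs _)%:R.
have : 0 <= K%:R :> R by []. lra.
Qed.

(** Squaring avoids half-integral exponents; rounding [n / 2] down is harmless because
    [weight K >= 1]. *)
Lemma half_power_le K n : (1 < K)%N ->
  (npairs K ^ (n %/ 2))%N%:R ^+ 2 <= weight K ^+ n.
Proof.
move=> K1; have w1 : 1 <= weight K.
  apply: le_trans (npairs_le_weight K1); rewrite ler1n.
  by case: K K1 => [|[|K]] // _; elim: K => // k ih; rewrite npairsS //; lia.
rewrite natrX -exprM; apply: (@le_trans _ _ (weight K ^+ (n %/ 2 * 2))).
  by apply: lerXn2r; rewrite ?nnegrE ?weight_ge0 ?npairs_le_weight.
by rewrite ler_weXn2l // leq_trunc_div.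
Qed.

Lemma pairs_bound_sq m q r : (1 < q)%N ->
  (pairs_bound m q r)%:R ^+ 2 <= weight q.+1 ^+ r * weight q ^+ (m - r).
Proof.
move=> q1; rewrite pairs_boundE natrM exprMn.
by apply: ler_pM; rewrite ?sqr_ge0 // half_power_le // ltnW.
Qed.

End Weights.

Lemma uniq_flatten_pairs (X : seq nat) (g : nat -> nat) :
  uniq X -> {in X &, injective g} -> {in X &, forall x y, x != g y} ->
  uniq (flatten [seq [:: x; g x] | x <- X]).
Proof.
move=> uX ig xg; have fE Y : flatten [seq [:: x; g x] | x <- Y] =i Y ++ map g Y.
  elim: Y => //= x Y ih z; rewrite !inE ih !mem_cat !inE.
  by case: (z == x) (z \in Y) (z == g x) => [] [] [].
elim: X uX ig xg => //= x X ih /andP[xX uX] ig xg.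
have xgx : x != g x by apply: xg; exact: mem_head.
have xgX : x \notin map g X.
  by apply/mapP => -[y yX /eqP]; apply/negP/xg; rewrite ?mem_head // inE yX orbT.
have gxX : g x \notin X.
  by apply/negP => gX; have := xg (g x) x; rewrite inE gX orbT mem_head eqxx => /(_ isT isT).
have gxgX : g x \notin map g X.
  apply/mapP => -[y yX /ig e]; move: xX; rewrite e ?mem_head ?yX //.
  by rewrite inE yX orbT.
rewrite !inE !fE !mem_cat !negb_or xgx xX xgX gxX gxgX /=; apply: ih => //.
  by move=> y z yX zX; apply: ig; rewrite inE ?yX ?zX orbT.
by move=> y z yX zX; apply: xg; rewrite inE ?yX ?zX orbT.
Qed.

(** * Splitting by whether some [m + u] with [u] in the window belongs to [S] *)

Section Part.
Variables (f m : nat).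

Definition window : seq nat :=
  iota ((2 * (f - 2 * m) + 4) %/ 5) ((f - 2 * m + 1) %/ 2 - (2 * (f - 2 * m) + 4) %/ 5).

Lemma mem_window i : (i \in window) = ((2 * (f - 2 * m) <= 5 * i) && (2 * i < f - 2 * m))%N.
Proof. rewrite mem_iota; lia. Qed.

Lemma size_window : ((f - 2 * m) %/ 10 <= (size window).+1)%N.
Proof. rewrite size_iota; lia. Qed.

Definition sgs_mult_shift u : {set f.-tuple bool} :=
  [set A in sgs_mult f m | nth false A (m + u)].

Definition sgs_mult_window0 : {set f.-tuple bool} :=
  [set A in sgs_mult f m | all (fun i => ~~ nth false A (m + i)) window].

Lemma sgs_mult_partition A : A \in sgs_mult f m ->
  A \in sgs_mult_window0 \/ exists2 u, u \in window & A \in sgs_mult_shift u.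
Proof.
move=> AF; rewrite inE AF /=; have [|/allPn[u uw /negbNE Au]] := boolP (all _ _); first by left.
by right; exists u => //; rewrite inE AF.
Qed.

(* The classes of more than 3 terms, if any, are few: there are [r] of them, when [q = 3]. *)
Definition tight := (0 < f %% m)%N && ((f %/ m == 2) || (f %/ m == 3) && (9 * (f %% m) < m))%N.

Hypothesis tightH : tight.
Let r := (f %% m)%N.
Let q := (f %/ m)%N.
Let r0 : (0 < r)%N. Proof. by have /andP[] := tightH. Qed.
Let m0 : (0 < m)%N.
Proof. by rewrite lt0n; apply/eqP => m_; move: tightH; rewrite /tight m_ divn0 andbF. Qed.
Let rm : (r < m)%N. Proof. by rewrite ltn_mod. Qed.
Let fqr : f = (q * m + r)%N. Proof. exact: divn_eq. Qed.
Let q23 : q = 2 /\ f = (2 * m + r)%N \/ [/\ q = 3, f = (3 * m + r)%N & (9 * r < m)%N].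
Proof.
case/andP: tightH => _ /orP[/eqP e|/andP[/eqP e h]]; [left|right]; split=> //;
by rewrite fqr /q e.
Qed.
Let q2 : (1 < q)%N. Proof. by case: q23 => [[-> _]|[-> _ _]]. Qed.

Lemma card_window0 :
  (#|sgs_mult_window0| * 8 ^ size window <= 6 ^ size window * pairs_bound m q r)%N.
Proof.
have wP i : i \in window -> [/\ (0 < i < m)%N, (0 < f - 2 * m - i < m)%N,
    class_size q r i = 3 & i \in reps m r].
  rewrite mem_window mem_reps /class_size => iw.
  case: q23 => [[q_ f_]|[q_ f_ rm_]]; rewrite q_; case: (ltnP i r) => ri; split; lia.
pose G := [seq [:: i] | i <- window].
have GE : flatten G = window by rewrite /G; elim: window => //= i s ->.
have sF : sgs_mult_window0 \subset sgs_mult f m by apply/subsetP => A; rewrite inE => /andP[].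
have := @card_groups f m q r r0 rm q2 fqr sgs_mult_window0 G 6 1 sF.
rewrite GE size_map expn1; apply.
- exact: iota_uniq.
- by move=> i /wP[].
- by move=> i /wP[].
- by move=> _ /mapP[i _ ->].
move=> _ /mapP[i iw ->]; have [im Rim K3 _] := wP i iw.
rewrite /= cats0; apply: (@ntraces_pair_absent f m q r _ _ _ _ (f - 2 * m)) => //.
  by case: q23 => [[_ ?]|[_ ? _]]; lia.
by move=> A; rewrite inE => /andP[_ /allP]; apply.
Qed.

(** With [R = f - 2 * m], the [x] in [[R/10, R/4)]. For [u] in [[2R/5, R/2)] the partner [R - x - u]
    lies in [(R/4, R/2]], so the pairs are disjoint and consist of representatives. When [q = 3],
    [9 * r < m] gives [r < R/10], so these classes have three terms. *)
Let shifts : seq nat :=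
  iota ((f - 2 * m + 9) %/ 10) ((f - 2 * m + 3) %/ 4 - (f - 2 * m + 9) %/ 10).

Lemma card_shift u : u \in window ->
  (#|sgs_mult_shift u| * 64 ^ size shifts <= 53 ^ size shifts * pairs_bound m q r)%N.
Proof.
rewrite mem_window => uw; pose g x := (f - 2 * m - (x + u))%N.
have xP x : x \in shifts -> ((f - 2 * m <= 10 * x) && (4 * x < f - 2 * m))%N.
  by rewrite mem_iota; lia.
have wP x : x \in shifts ->
    [/\ (x + u < f - 2 * m)%N, (0 < x < m)%N, (0 < g x < m)%N & (x + u < m)%N]
    /\ [/\ (g x + u < m)%N, class_size q r x = 3, class_size q r (g x) = 3,
      x \in reps m r & g x \in reps m r].
  move/xP; rewrite !mem_reps /class_size /g => xw.
  case: q23 => [[q_ f_]|[q_ f_ rm_]]; rewrite q_;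
    case: (ltnP x r) => ri; case: (ltnP (_ - _) r) => rgi; split; split; lia.
pose G := [seq [:: x; g x] | x <- shifts].
have GP i : i \in flatten G -> exists2 x, x \in shifts & (i == x) || (i == g x).
  by case/flattenP => _ /mapP[x xs ->]; rewrite !inE => h; exists x.
have sF : sgs_mult_shift u \subset sgs_mult f m by apply/subsetP => A; rewrite inE => /andP[].
have := @card_groups f m q r r0 rm q2 fqr (sgs_mult_shift u) G 53 2 sF.
rewrite size_map; apply.
- apply: uniq_flatten_pairs; first exact: iota_uniq.
    by move=> x y /xP ? /xP ?; rewrite /g; lia.
  by move=> x y /xP ? /xP ?; rewrite /g; lia.
- by move=> i /GP[x /wP[_ [_ _ _ ? ?]]] /orP[] /eqP ->.
- by move=> i /GP[x /wP[_ [_ ? ? _ _]]] /orP[] /eqP ->.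
- by move=> _ /mapP[i _ ->].
move=> _ /mapP[x /wP[[? ? ? ?] [? ? ? _ _]] ->].
rewrite /= cats0; apply: (@ntraces_pair_shift f m q r _ _ _ _ (f - 2 * m) _ _ u) => //.
  by case: q23 => [[_ ?]|[_ ? _]]; lia.
by move=> A; rewrite inE => /andP[].
Qed.

End Part.

(** * The exponential saving for one multiplicity *)

Section PartBound.
Variables (R : realFieldType) (f m : nat).
Hypotheses (m0 : (0 < m)%N) (mf : (2 * m < f)%N).
Let q := (f %/ m)%N.
Let r := (f %% m)%N.
Let rm : (r < m)%N. Proof. by rewrite ltn_mod. Qed.
Let fqr : f = (q * m + r)%N. Proof. exact: divn_eq. Qed.
Let q2 : (1 < q)%N. Proof. by rewrite /q leq_divRL // ltnW. Qed.
(** A common rate for all savings: [2 * kappa = 1.93] is the base of [weight] from 4 on, and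
    [(6/8)^2] and [(53/64)^2] are below [kappa]. *)
Let kappa : R := 193 / 200.
(** A lower bound for the number of groups in either case; one is lost to rounding. *)
Let t := ((f - 2 * m) %/ 10).-1.

Let kappa_le n : (t <= n)%N -> kappa ^+ n <= kappa ^+ t.
Proof. by move=> tn; rewrite ler_wiXn2l // /kappa; lra. Qed.

Lemma pairs_bound_le : (pairs_bound m q r)%:R ^+ 2 <= 2 ^+ f :> R.
Proof.
apply: le_trans (pairs_bound_sq R _ _ q2) _.
have -> : (2 : R) ^+ f = (2 ^+ q.+1) ^+ r * (2 ^+ q) ^+ (m - r).
  by rewrite -!exprM -exprD; congr (_ ^+ _); rewrite [LHS]fqr; have := subnKC (ltnW rm); nia.
by apply: ler_pM; rewrite ?exprn_ge0 ?weight_ge0 //; apply: lerXn2r;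
  rewrite ?nnegrE ?exprn_ge0 ?weight_ge0 ?weight_le.
Qed.

(** If [m] divides [f] there is no such semigroup. For [q >= 4] every class has at least 4 terms.
    What remains is [q = 3] with [m <= 9 * r]: the four-term classes save [kappa ^ (4 * r)], and
    [f - 2 * m = m + r <= 10 * r]. *)
Lemma card_loose : ~~ tight f m ->
  #|sgs_mult f m|%:R ^+ 2 <= 2 ^+ f * kappa ^+ t.
Proof.
have k0 n : 0 <= kappa ^+ n by apply: exprn_ge0; rewrite /kappa; lra.
have [r0|r0] := posnP r.
  suff -> : sgs_mult f m = set0.
    by rewrite cards0 expr0n /= mulr_ge0 ?k0 ?exprn_ge0.
  apply/setP => A; rewrite [RHS]inE; apply/negP => AF.
  apply: (@sgs_mult_frobenius _ _ m0 A 0 m q.-1 AF (sgs_mult0 AF) (sgs_mult_mem AF)).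
  by rewrite [RHS]fqr r0; case: (q) q2 => //= k _; rewrite mulSn; lia.
rewrite /tight -/r -/q r0 /= negb_or => /andP[q2' q3].
have := card_sgs_mult r0 rm q2 fqr (subxx (sgs_mult f m)).
rewrite -(ler_nat R) => /(lerXn2r 2); rewrite !nnegrE => /(_ (ler0n _ _) (ler0n _ _)) h.
apply: le_trans h _; apply: le_trans (pairs_bound_sq R _ _ q2) _.
have [q4|q4] := leqP 4 q.
  apply: (@le_trans _ _ (2 ^+ f * kappa ^+ f)).
    rewrite /weight ltnNge ltnW //= ltnNge q4 /= -!exprM -exprD -exprMn.
    have -> : 2 * kappa = 193 / 100 by rewrite /kappa; field.
    rewrite le_eqVlt; apply/orP; left; apply/eqP; congr (_ ^+ _).
    by rewrite [RHS]fqr; have := subnKC (ltnW rm); nia.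
  by rewrite ler_pM2l ?exprn_gt0 // kappa_le // /t; lia.
have q_3 : q = 3 by move/eqP: q2'; lia.
rewrite q_3 eqxx /= -leqNgt in q3.
apply: (@le_trans _ _ (2 ^+ f * kappa ^+ (4 * r))).
  rewrite q_3 /weight /= -!exprM (_ : f = 4 * r + 3 * (m - r))%N; last by rewrite [LHS]fqr q_3; lia.
  rewrite exprD mulrAC -exprMn.
  by have -> : 2 * kappa = 193 / 100 by rewrite /kappa; field.
rewrite ler_pM2l ?exprn_gt0 // kappa_le // /t.
by move: fqr; rewrite q_3 => ->; lia.
Qed.

Let saving (a b c n : nat) : (0 < b)%N -> (a%:R / b%:R : R) ^+ 2 <= kappa -> (t <= n)%N ->
  (c * b ^ n <= a ^ n * pairs_bound m q r)%N -> c%:R ^+ 2 <= 2 ^+ f * kappa ^+ t :> R.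
Proof.
move=> b0 abk tn; rewrite -(ler_nat R) !natrM !natrX => h.
have {}h : c%:R <= (a%:R / b%:R) ^+ n * (pairs_bound m q r)%:R :> R.
  by rewrite expr_div_n mulrAC ler_pdivlMr ?exprn_gt0 ?ltr0n.
apply: (@le_trans _ _ (((a%:R / b%:R) ^+ n * (pairs_bound m q r)%:R) ^+ 2)).
  by rewrite lerXn2r // nnegrE // (le_trans _ h).
rewrite exprMn mulrC ler_pM ?sqr_ge0 ?pairs_bound_le //.
rewrite -exprM mulnC exprM; apply: le_trans (kappa_le tn).
by rewrite lerXn2r // nnegrE ?sqr_ge0 // (le_trans _ abk) ?sqr_ge0.
Qed.

Lemma card_window0_sq : #|sgs_mult_window0 f m|%:R ^+ 2 <= 2 ^+ f * kappa ^+ t.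
Proof.
have [tg|/card_loose] := boolP (tight f m).
  apply: saving (card_window0 tg) => //; first by rewrite /kappa; lra.
  by have := size_window f m; rewrite /t; lia.
apply: le_trans; rewrite lerXn2r ?nnegrE // ler_nat.
by apply/subset_leq_card/subsetP => A; rewrite inE => /andP[].
Qed.

Lemma card_shift_sq u : u \in window f m ->
  #|sgs_mult_shift f m u|%:R ^+ 2 <= 2 ^+ f * kappa ^+ t.
Proof.
move=> uw; have [tg|/card_loose] := boolP (tight f m).
  apply: saving (card_shift tg uw) => //; first by rewrite /kappa; lra.
  by rewrite /t size_iota; lia.
apply: le_trans; rewrite lerXn2r ?nnegrE // ler_nat.
by apply/subset_leq_card/subsetP => A; rewrite inE => /andP[].
Qed.

End PartBound.

(** * Semigroups of multiplicity close to [f / 2] *)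

Lemma size_bitseqs n b : b \in bitseqs n -> size b = n.
Proof.
elim: n b => [|n ih] b /=; first by rewrite inE => /eqP ->.
by rewrite mem_cat => /orP[] /mapP[c /ih <- ->].
Qed.

Section Chernoff.
Variable R : realFieldType.

Lemma bernoulli_ineq (x : R) n : -1 <= x -> 1 + n%:R * x <= (1 + x) ^+ n.
Proof.
move=> x1; elim: n => [|n ih]; first by rewrite expr0 mul0r addr0.
have h : 0 <= (1 + x) * ((1 + x) ^+ n - (1 + n%:R * x)) by apply: mulr_ge0; lra.
have : 0 <= n%:R * (x * x) by rewrite mulr_ge0 // -expr2 sqr_ge0.
by rewrite exprS -natr1; move: h; nra.
Qed.

Lemma sum_bitseqs (p : pred bool) (x w : R) n : p true != p false ->
  \sum_(b <- bitseqs n) x ^+ count p b * w ^+ count (predC p) b = (x + w) ^+ n.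
Proof.
move=> pp; elim: n => [|n ih]; first by rewrite big_seq1 !expr0 mulr1.
rewrite /= big_cat !big_map exprS -ih mulrDl !mulr_sumr /=.
case: (p true) (p false) pp => [] [] //= _; last rewrite addrC; congr (_ + _);
  by apply: eq_bigr => b _; rewrite ?add1n ?add0n exprS; ring.
Qed.

(* Exponential moments with weights [1 + y] and [1 - y], where [y = 1 / (2 k)]. *)
Lemma count_bitseqs_tail (p : pred bool) n d k : p true != p false ->
  (0 < k)%N -> (n <= d * k)%N ->
  (count (fun b => n + d <= 2 * count p b)%N (bitseqs n))%:R * (1 + (8 * k%:R)^-1) ^+ d
    <= 2 ^+ n :> R.
Proof.
move=> pp k0 nd; pose y : R := (2 * k%:R)^-1.
have k1 : 1 <= k%:R :> R by rewrite ler1n.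
have ky : k%:R * y = 1 / 2 by rewrite /y; field; lra.
have y0 : 0 < y by rewrite invr_gt0; lra.
have y1 : y <= 1 / 2 by move: ky; nra.
have -> : 2 ^+ n = \sum_(b <- bitseqs n) (1 + y) ^+ count p b * (1 - y) ^+ count (predC p) b.
  by rewrite sum_bitseqs //; congr (_ ^+ _); ring.
rewrite -sum1_count natr_sum mulr_suml big_mkcond /= big_seq [leRHS]big_seq.
apply: ler_sum => b /size_bitseqs sb.
case: ifPn => [tl|_]; last by rewrite mulr_ge0 ?exprn_ge0 //; lra.
rewrite mul1r; set c := count p b; have cs := count_predC p b.
have -> : count (predC p) b = (n - c)%N by rewrite -sb -cs addKn.
have cn : (c <= n)%N by rewrite -sb count_size.
(* Match each bit outside [p] with one inside; [2 * c - n >= d] bits inside remain. *)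
have -> : (1 + y) ^+ c * (1 - y) ^+ (n - c) =
    (1 - y ^+ 2) ^+ (n - c) * (1 + y) ^+ (2 * c - n).
  have {1}-> : c = (n - c + (2 * c - n))%N by rewrite /c in tl cn *; lia.
  rewrite exprD mulrAC -exprMn; congr (_ ^+ _ * _); ring.
apply: (@le_trans _ _ ((1 - y ^+ 2) ^+ (d * k) * (1 + y) ^+ d)); last first.
  apply: ler_pM; rewrite ?exprn_ge0 //; try nra.
    by apply: ler_wiXn2l; [nra|nra|lia].
  by apply: ler_weXn2l; [lra|rewrite /c in tl cn *; lia].
have l0 : 0 <= 1 + (8 * k%:R)^-1 :> R by rewrite addr_ge0 // invr_ge0; lra.
have r0 : 0 <= (1 - y ^+ 2) ^+ k * (1 + y) by rewrite mulr_ge0 ?exprn_ge0 //; nra.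
rewrite mulnC exprM -exprMn; apply: lerXn2r => //.
(* As [k * y = 1/2], the product is at least [(1 - y/2) * (1 + y)], which is at least [1 + y/4]
   because [y <= 1/2]. *)
have h : 1 - k%:R * y ^+ 2 <= (1 - y ^+ 2) ^+ k.
  by rewrite -mulrN; apply: bernoulli_ineq; nra.
apply: (@le_trans _ _ ((1 - k%:R * y ^+ 2) * (1 + y))); last by rewrite ler_wpM2r //; lra.
have -> : (8 * k%:R)^-1 = y / 4 by rewrite /y; field; lra.
by rewrite expr2 mulrA ky; nra.
Qed.

End Chernoff.

Section High.
Variables (f D : nat).

(** The semigroups of multiplicity greater than [(f - D) / 2]. *)
Definition sgs_high : {set f.-tuple bool} :=
  [set A in sgs f | all (fun x => (2 * x + D <= f) ==> ~~ nth false A x)%N (iota 1 f)].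

Let n := (f.-1 - f %/ 2)%N.
Let top := iota (f %/ 2).+1 n.
Let mid := iota ((f - D) %/ 2).+1 (f %/ 2 - (f - D) %/ 2).

Definition far E (A : f.-tuple bool) : bool :=
  let c := count id A in ((f + E <= 4 * c) || (4 * c + E <= f))%N.

Lemma count_high A : (0 < f)%N -> A \in sgs_high ->
  (count id (map (nth false A) top) < count id A <=
   count id (map (nth false A) top) + size mid + 1)%N.
Proof.
move=> f0; rewrite inE => /andP[AS /allP hi].
have -> : count id A = count id (map (nth false A) (iota 0 f)).
  by rewrite -{1}(mkseq_nth false A) size_tuple.
have -> : iota 0 f = 0%N :: iota 1 ((f - D) %/ 2) ++ mid ++ top.
  have fE : f = ((f - D) %/ 2 + (f %/ 2 - (f - D) %/ 2 + n)).+1 by rewrite /n; lia.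
  rewrite [in LHS]fE /= !iotaD /mid /top; congr (_ :: _ ++ _ ++ iota _ _); lia.
have A0 : nth false A 0 by move: AS; rewrite inE => /andP[].
rewrite /= A0 !map_cat !count_cat.
have -> : count id (map (nth false A) (iota 1 ((f - D) %/ 2))) = 0%N.
  apply/eqP; rewrite -leqn0 leqNgt -has_count; apply/hasPn => _ /mapP[x xi ->] /=.
  apply: (implyP (hi x _)); move: xi; rewrite !mem_iota; lia.
have := count_size id (map (nth false A) mid); rewrite size_map.
by move: (count id (map _ mid)) (count id (map _ top)) (size mid) => a b c /=; lia.
Qed.

(** The trace on [mid ++ top] determines [A]. If [A] is far, its members or its gaps on [top] number
    at least [(n + d) / 2]; the slack in [dE] covers [mid], the element 0 and the rounding of
    [f / 2]. The two tails and the choices on [mid] give [2 ^ (size mid).+1]. *)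
Lemma card_high_far (R : realFieldType) E d k : (0 < f)%N -> (0 < k)%N ->
  (n <= d * k)%N -> (2 * d + 4 * size mid + 6 <= E)%N ->
  #|[set A in sgs_high | far E A]|%:R * (1 + (8 * k%:R)^-1) ^+ d
    <= 2 ^+ (size mid).+1 * 2 ^+ n :> R.
Proof.
move=> f0 k0 nd dE; set F := [set A in _ | _].
pose P p (b : bitseq) := (n + d <= 2 * count p b)%N.
have sn b : b \in bitseqs n -> count negb b = (n - count id b)%N.
  by move=> /size_bitseqs <-; rewrite -(count_predC id b) addKn; apply: eq_count.
have h : (#|F| <= 2 ^ size mid * (count (P id) (bitseqs n) + count (P negb) (bitseqs n)))%N.
  apply: (@leq_trans (ntraces F (mid ++ top))).
    apply: card_le_ntraces => A B; rewrite /F !inE =>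
       /andP[/andP[AS /allP hA] _] /andP[/andP[BS /allP hB] _] AB x xf.
    have [->|x0] := posnP x.
      by move: AS BS => /andP[-> _] /andP[-> _].
    have [xD|xD] := leqP (2 * x + D) f.
      have xi : x \in iota 1 f by rewrite mem_iota; lia.
      by move: (hA _ xi) (hB _ xi); rewrite xD /= => /negbTE -> /negbTE ->.
    by apply: AB; rewrite mem_cat !mem_iota /n; lia.
  apply: leq_trans (ntraces_cat _ _ _) _; apply: leq_mul.
    by rewrite (leq_trans (max_card _)) // card_tuple card_bool.
  apply: (@leq_trans (count (predU (P id) (P negb)) (bitseqs n))); last first.
    by rewrite -count_predUI leq_addr.
  rewrite -[in leqRHS](size_iota (f %/ 2).+1 n) -/top.
  apply: ntraces_bits => A; rewrite /F inE => /andP[/(count_high f0)/andP[h1 h2] fA].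
  have st : size (map (nth false A) top) = n by rewrite size_map size_iota.
  have st' : map (nth false A) top \in bitseqs n by rewrite -[in X in _ \in X]st mem_bitseqs.
  move: fA; rewrite /far /= /P sn // => fA.
  have := count_size id (map (nth false A) top); rewrite st => c.
  move: fA h1 h2 c dE; rewrite /n.
  move: (count id (map (nth false A) top)) (count id A) (size mid) => a b c *.
  lia.
have z0 : 0 <= (1 + (8 * k%:R)^-1) ^+ d :> R by rewrite exprn_ge0 // addr_ge0 // invr_ge0 mulr_ge0.
move: h; rewrite -(ler_nat R) natrM natrX natrD => /(ler_wpM2r z0)/le_trans; apply.
rewrite exprSr -!mulrA ler_pM2l ?exprn_gt0 // mulrDl [leRHS]mulrDl mul1r.
by apply: lerD; apply: count_bitseqs_tail.
Qed.

End High.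

(** * Summing over small multiplicities, and a lower bound for the total *)

Lemma card_cover (R : realFieldType) (T I : finType) (F : {set T}) (P : pred I)
    (G : I -> {set T}) (c : R) : 0 <= c ->
  (forall A, A \in F -> exists2 i, P i & A \in G i) ->
  (forall i, P i -> #|G i|%:R <= c) -> #|F|%:R <= #|I|%:R * c.
Proof.
move=> c0 FG Gc; apply: (@le_trans _ _ (\sum_(i | P i) #|G i|%:R)).
  rewrite -natr_sum ler_nat.
  apply: (@leq_trans #|\bigcup_(i | P i) G i|).
    by apply/subset_leq_card/subsetP => A /FG[i Pi AG]; apply/bigcupP; exists i.
  elim/big_rec2: _ => [|i n B _ ih]; first by rewrite cards0.
  by apply: leq_trans (leq_card_setU _ _) _; rewrite leq_add2l.
apply: (@le_trans _ _ (\sum_(i | P i) c)); first exact: ler_sum.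
by rewrite sumr_const -[leLHS]mulr_natl ler_wpM2r // ler_nat max_card.
Qed.

Lemma sgs_multP f D (A : f.-tuple bool) : A \in sgs f -> A \notin sgs_high f D ->
  exists m, [/\ (0 < m)%N, (2 * m + D <= f)%N & A \in sgs_mult f m].
Proof.
move=> AS; rewrite inE AS /= => /allPn[x]; rewrite mem_iota negb_imply negbK => x0 /andP[xD Ax].
have ex : exists x, (0 < x)%N && nth false A x by exists x; rewrite Ax andbT; case/andP: x0.
case: (ex_minnP ex) => m /andP[m0 Am] mmin; exists m; split => //.
  by have := mmin x; rewrite Ax andbT; case/andP: x0 => -> _ /(_ isT); lia.
rewrite inE AS Am; apply/allP => y; rewrite mem_iota => ym; apply/negP => Ay.
by have := mmin y; rewrite Ay andbT; lia.
Qed.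

(** Union bound over the multiplicity [m] and the cases of [sgs_mult_partition], with [None] for
    [sgs_mult_window0]. The saving is least at [f - 2 * m = D]. *)
Lemma card_low (R : rcfType) f D : (0 < D)%N ->
  #|sgs f :\: sgs_high f D|%:R
    <= (f.+1 ^ 2)%N%:R * Num.sqrt (2 ^+ f * (193 / 200) ^+ (D %/ 10).-1) :> R.
Proof.
move=> D0; set s := Num.sqrt _.
have s0 : 0 <= s by exact: sqrtr_ge0.
pose P (i : 'I_f * option 'I_f) := [&& (0 < i.1)%N, (2 * i.1 + D <= f)%N
  & if i.2 is Some u then val u \in window f i.1 else true].
pose G (i : 'I_f * option 'I_f) :=
  if i.2 is Some u then sgs_mult_shift f i.1 u else sgs_mult_window0 f i.1.
have toS (x : R) m : (2 * m + D <= f)%N -> 0 <= x ->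
    x ^+ 2 <= 2 ^+ f * (193 / 200) ^+ ((f - 2 * m) %/ 10).-1 -> x <= s.
  move=> mD x0 h.
  rewrite -[leLHS]ger0_norm // -sqrtr_sqr; apply: ler_wsqrtr.
  apply: le_trans h _; rewrite ler_pM2l ?exprn_gt0 //.
  by apply: ler_wiXn2l; [lra|lra|lia].
apply: (@le_trans _ _ (#|{: 'I_f * option 'I_f}|%:R * s)).
  apply: (@card_cover _ _ _ _ P G) => //.
    move=> A; rewrite inE => /andP[Ah AS].
    have [m [m0 mD Am]] := sgs_multP AS Ah.
    have mf : (m < f)%N by lia.
    case: (sgs_mult_partition Am) => [A0|[u uw Au]].
      by exists (Ordinal mf, None) => //; rewrite /P /= m0 mD.
    have uf : (u < f)%N by move: uw; rewrite mem_window; lia.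
    by exists (Ordinal mf, Some (Ordinal uf)) => //; rewrite /P /= m0 mD.
  move=> [m [u|]]; rewrite /P /= => /and3P[m0 mD uw]; apply: (toS _ m) => //; rewrite /G /=.
    by apply: card_shift_sq => //; lia.
  by apply: card_window0_sq => //; lia.
rewrite ler_wpM2r // ler_nat card_prod card_option !card_ord; nia.
Qed.

(** Every subset of [(f/2, f)], together with 0, occurs: two elements above [f / 2] add up to more
    than [f]. *)
Lemma card_sgs_ge f : (0 < f)%N -> (2 ^ (f.-1 - f %/ 2) <= #|sgs f|)%N.
Proof.
move=> f0; set n := (f.-1 - f %/ 2)%N.
pose h (b : n.-tuple bool) : f.-tuple bool :=
  [tuple (i == 0%N :> nat) || (f %/ 2 < i)%N && nth false b (i - (f %/ 2).+1) | i < f].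
have hE b x : nth false (h b) x =
    (x < f)%N && ((x == 0%N) || (f %/ 2 < x)%N && nth false b (x - (f %/ 2).+1)).
  have [xf|xf] := ltnP x f; last by rewrite nth_default ?size_tuple.
  by rewrite -[x in LHS]/(val (Ordinal xf)) -tnth_nth tnth_mktuple.
rewrite -card_bool -(card_tuple n) -(card_imset (f := h)).
  apply/subset_leq_card/subsetP => _ /imsetP[b _ ->]; rewrite inE /truncated_semigroup hE f0 /=.
  apply/forallP => x; apply/forallP => y; rewrite !hE !ltn_ord /=.
  have xf := ltn_ord x; have yf := ltn_ord y.
  have [->|x0] := posnP x; first by apply/implyP => h'; rewrite add0n yf h' implybT andbT; lia.
  have [->|y0] := posnP y; first
    by apply/implyP; rewrite andbT addn0 xf (gtn_eqF x0) => ->; rewrite implybT andbT; lia.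
  by apply/implyP => /andP[/andP[hx _] /andP[hy _]]; lia.
move=> b c bc; apply/val_inj/(@eq_from_nth _ false) => [|i]; rewrite !size_tuple // => ilt.
have := hE b (i + (f %/ 2).+1)%N; rewrite bc hE addnK (_ : _ < f)%N; last by rewrite /n in ilt; lia.
by rewrite addnS /= (_ : f %/ 2 < _)%N //; lia.
Qed.

(** * Exponential decay and the rarity of far semigroups *)

Section Small.
Variable R : archiRealFieldType.

(** By Bernoulli, [x] to a third of the exponent grows at least linearly, so its cube dominates a
    multiple of [(n + 1) ^ 3]; the spare factor [n + 1] absorbs the constants. *)
Lemma sqr_le_geometric (x delta : R) c : 1 < x -> 0 < delta -> (0 < c)%N ->
  exists N, forall n, (N <= n)%N -> n.+1%:R ^+ 2 <= delta * x ^+ (n %/ c).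
Proof.
(* The minimum ensures [y * (t + 1) <= 1 + t * (x - 1)]. *)
move=> x1 d0 c0; pose y := Num.min 1 (x - 1).
have y0 : 0 < y by rewrite lt_min ltr01 subr_gt0.
have yx : y <= x - 1 by rewrite ge_min lexx orbT.
have y1 : y <= 1 by rewrite ge_min lexx.
have C0 : 0 < (3 * c)%N%:R :> R by rewrite ltr0n muln_gt0.
pose a := y / (3 * c)%N%:R.
have a0 : 0 < a by rewrite divr_gt0.
exists (Num.bound (delta * a ^+ 3)^-1) => n Nn.
have big : 1 <= delta * a ^+ 3 * n.+1%:R.
  have e0 : 0 < delta * a ^+ 3 by rewrite mulr_gt0 ?exprn_gt0.
  rewrite mulrC -ler_pdivrMr // div1r.
  have := archi_boundP (ltW (_ : 0 < (delta * a ^+ 3)^-1)); rewrite invr_gt0 => /(_ e0) /ltW h.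
  by apply: le_trans h _; rewrite ler_nat; apply: leq_trans Nn _.
pose t := (n %/ c %/ 3)%N.
have nt : (n.+1 <= 3 * c * t.+1)%N.
  by rewrite /t -divnMA mulnC [(c * 3)%N]mulnC; apply: ltn_ceil; rewrite muln_gt0.
have low : a * n.+1%:R <= x ^+ t.
  apply: (@le_trans _ _ (1 + t%:R * (x - 1))); last first.
    by have := @bernoulli_ineq R (x - 1) t; rewrite [1 + (x - 1)]addrC subrK; apply; lra.
  apply: (@le_trans _ _ (y * t.+1%:R)).
    rewrite /a mulrAC ler_pdivrMr // -mulrA ler_pM2l //.
    by rewrite -natrM ler_nat mulnC.
  by rewrite -natr1; have : 0 <= t%:R :> R by []; nra.
apply: (@le_trans _ _ (delta * (x ^+ t) ^+ 3)).
  apply: (@le_trans _ _ (delta * (a * n.+1%:R) ^+ 3)); last first.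
    rewrite ler_pM2l //; apply: lerXn2r => //; rewrite nnegrE.
      by rewrite mulr_ge0 // ltW.
    by apply: exprn_ge0; lra.
  rewrite exprMn mulrA [n.+1%:R ^+ 3]exprS mulrA.
  by rewrite ler_peMl ?sqr_ge0.
rewrite ler_pM2l // -exprM ler_weXn2l ?ltW // leq_trunc_div //.
Qed.

Lemma pow2_le f : (0 < f)%N -> 2 ^+ f <= (2 * 2 ^+ (f.-1 - f %/ 2)) ^+ 2 :> R.
Proof.
by move=> f0; rewrite -exprS -exprM ler_weXn2l ?ler1n //; lia.
Qed.

End Small.

(** Uses [193 / 200 <= (99 / 100) ^ 2]; the power of 2 on the right is the lower bound of
    [card_sgs_ge]. *)
Lemma sqrt_decay (R : realType) f a : (0 < f)%N ->
  Num.sqrt (2 ^+ f * (193 / 200) ^+ a)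
    <= 2 * 2 ^+ (f.-1 - f %/ 2) / (100 / 99) ^+ a :> R.
Proof.
move=> f0; have w0 : 0 < (100 / 99 : R) by lra.
have r0 : 0 <= 2 * 2 ^+ (f.-1 - f %/ 2) / (100 / 99) ^+ a :> R.
  by rewrite divr_ge0 ?mulr_ge0 // exprn_ge0 // ltW.
rewrite -[leRHS]ger0_norm // -sqrtr_sqr; apply: ler_wsqrtr; rewrite [leRHS]exprMn.
have k0 : 0 <= (193 / 200 : R) by lra.
apply: ler_pM; [exact: exprn_ge0|exact: exprn_ge0|exact: pow2_le|].
rewrite -exprVn -exprM mulnC exprM; apply: lerXn2r; rewrite ?nnegrE ?sqr_ge0 //.
by rewrite invf_div; lra.
Qed.

(** Parameters for [card_high_far] with [k = 4 * p]. As [1 + 1/(8k)] to the power [8 * k] is at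
    least 2, the last inequality pays for the factor [2 ^ s] and leaves a surplus exponent linear in
    [f]. The 512 in [D] makes [32 * p * s <= E / 16]. *)
Lemma far_parameters p f (E := (f %/ p)%N) (D := (E %/ (512 * p))%N)
    (d := (E %/ 4)%N) (s := (f %/ 2 - (f - D) %/ 2)%N) :
  (0 < p)%N -> (4096 * p * p <= f)%N ->
  [/\ (0 < D)%N, (f.-1 - f %/ 2 <= d * (4 * p))%N, (2 * d + 4 * s + 6 <= E)%N
    & (8 * (4 * p) * s + f %/ (p * 8) <= d)%N].
Proof.
move=> p0 pf.
have E_large : (4096 * p <= E)%N by rewrite leq_divRL.
have Ef : (p * E <= f < p * E.+1)%N by rewrite mulnC leq_trunc_div mulnC ltn_ceil.
have DE : (512 * (p * D) <= E)%N by rewrite mulnA mulnC leq_trunc_div.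
have D0 : (0 < D)%N by rewrite divn_gt0; lia.
have sD : (s <= D)%N by clear -D0; rewrite {}/s; move: D D0 => D; lia.
have psD : (p * s <= p * D)%N by rewrite leq_mul2l sD orbT.
have DpD : (D <= p * D)%N by rewrite leq_pmull.
have dE : (4 * d <= E < 4 * d + 4)%N by rewrite /d; move: (E) => E'; lia.
have fE : (f %/ (p * 8) = E %/ 8)%N by rewrite divnMA.
rewrite {}fE; move: E D d s p0 pf E_large Ef DE D0 sD psD DpD dE => E D d s *.
split => //; try lia.
suff : (p * E.+1 <= p * (4 * d + 4))%N.
  have -> : (p * (4 * d + 4) = d * (4 * p) + 4 * p)%N by ring.
  have : (p * 4096 <= p * p * 4096)%N by rewrite leq_mul2r leq_pmull.
  lia.
by rewrite leq_mul2l; apply/orP; right; lia.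
Qed.

(** [card_low] handles the semigroups outside [sgs_high] and [card_high_far] the far ones inside;
    each part is at most half of [delta * 2 ^ n]. *)
Lemma card_far (R : realType) p (delta : R) : (0 < p)%N -> 0 < delta ->
  exists N, forall f, (N <= f)%N ->
    #|[set A in sgs f | far (f %/ p) A]|%:R <= delta * #|sgs f|%:R :> R.
Proof.
move=> p0 d0; pose k := (4 * p)%N.
pose z : R := 1 + (8 * k%:R)^-1.
have k0 : 0 < k%:R :> R by rewrite ltr0n muln_gt0 p0.
have v0 : 0 < (8 * k%:R)^-1 :> R by rewrite invr_gt0 mulr_gt0.
have z1 : 1 < z by rewrite ltrDl.
have z2 : 2 <= z ^+ (8 * k).
  apply: le_trans (bernoulli_ineq (8 * k) _); last lra.
  by rewrite natrM divff //; lra.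
have [N1 low_small] : exists N, forall n, (N <= n)%N ->
    n.+1%:R ^+ 2 <= delta / 8 * (100 / 99 : R) ^+ (n %/ (p * (512 * p) * 10)).
  by apply: sqr_le_geometric; [lra|lra|rewrite !muln_gt0 p0].
have [N2 high_small] : exists N, forall n, (N <= n)%N ->
    n.+1%:R ^+ 2 <= delta / 4 * z ^+ (n %/ (p * 8)).
  by apply: sqr_le_geometric; [lra|lra|rewrite !muln_gt0 p0].
exists (N1 + N2 + 4096 * p * p)%N => f Nf.
have N1f : (N1 <= f)%N by lia.
have N2f : (N2 <= f)%N by lia.
have pf : (4096 * p * p <= f)%N by lia.
have f0 : (0 < f)%N by apply: leq_trans pf; rewrite !muln_gt0 p0.
clear Nf; have [] := far_parameters p0 pf.
set E := (f %/ p)%N; set D := (E %/ (512 * p))%N; set d := (E %/ 4)%N.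
set s := (f %/ 2 - (f - D) %/ 2)%N; set n := (f.-1 - f %/ 2)%N.
move=> D0 n_le s_le exps.
have N_ge : 2 ^+ n <= #|sgs f|%:R :> R by rewrite -natrX ler_nat card_sgs_ge.
have p2 : 0 < 2 ^+ n :> R by rewrite exprn_gt0.
have z0 j : 0 < z ^+ j by rewrite exprn_gt0 // (lt_trans ltr01).
have high : #|[set A in sgs_high f D | far E A]|%:R <= delta / 2 * 2 ^+ n.
  set H := #|[set A in sgs_high f D | far E A]|%:R.
  have k0' : (0 < k)%N by rewrite muln_gt0.
  have := @card_high_far f D R E d k f0 k0' n_le; rewrite size_iota -/z -/s -/n.
  move=> /(_ s_le) Hd.
  have H0 : 0 <= H by [].
  have s2 : 2 ^+ s <= z ^+ (8 * k * s).
    by rewrite exprM lerXn2r ?nnegrE // ltW.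
  have e1 : 1 <= delta / 4 * z ^+ (f %/ (p * 8)).
    have /high_small := N2f.
    by apply: le_trans; rewrite -natrX ler1n expn_gt0.
  have He : H * z ^+ (f %/ (p * 8)) <= 2 * 2 ^+ n.
    (* [z ^ (8 * k * s)] absorbs [2 ^ s]; only the surplus exponent is kept. *)
    rewrite -(ler_pM2l (z0 (8 * k * s)%N)).
    apply: (@le_trans _ _ (H * z ^+ d)).
      rewrite mulrCA ler_wpM2l // -exprD; apply: ler_weXn2l => //; exact: ltW.
    by apply: le_trans Hd _; rewrite exprSr -mulrA ler_wpM2r // mulr_ge0 // ltW.
  have := ler_wpM2l H0 e1; rewrite mulr1 => /le_trans; apply.
  rewrite mulrCA; apply: (@le_trans _ _ (delta / 4 * (2 * 2 ^+ n))).
    by rewrite ler_wpM2l // divr_ge0 // ltW.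
  by rewrite mulrA; apply: ler_wpM2r; [exact: ltW|clear -d0; lra].
have low : #|sgs f :\: sgs_high f D|%:R <= delta / 2 * 2 ^+ n.
  apply: le_trans (card_low R f D0) _.
  pose w : R := 100 / 99.
  have w1 : 1 < w by rewrite /w; clear; lra.
  have w0 j : 0 < w ^+ j by rewrite exprn_gt0 // (lt_trans ltr01).
  have sq := sqrt_decay R (D %/ 10).-1 f0.
  apply: le_trans (ler_wpM2l _ sq) _; first by [].
  have /low_small := N1f.
  rewrite natrX (divnMA _ (p * _)%N) (divnMA _ p) -/E -/D => fw.
  apply: le_trans (ler_wpM2r _ fw) _.
    by rewrite divr_ge0 ?mulr_ge0 // ltW.
  set a := (D %/ 10).-1.
  (* The predecessor in [a] costs one factor [w], which is below 2. *)
  have wa : w ^+ (D %/ 10) <= w * w ^+ a.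
    by rewrite -exprS; apply: ler_weXn2l; [exact: ltW|clear; rewrite /a; lia].
  rewrite -/w -/n; have wa' : w ^+ (D %/ 10) / w ^+ a <= w by rewrite ler_pdivrMr.
  have -> : delta / 8 * w ^+ (D %/ 10) * (2 * 2 ^+ n / w ^+ a) =
      delta / 4 * 2 ^+ n * (w ^+ (D %/ 10) / w ^+ a) by field; exact: lt0r_neq0.
  have d4 : 0 <= delta / 4 * 2 ^+ n by apply: mulr_ge0; apply: ltW => //; exact: divr_gt0.
  apply: le_trans (ler_wpM2l d4 wa') _; rewrite mulrAC; apply: ler_wpM2r; first exact: ltW.
  rewrite /w; clear -d0; lra.
apply: (@le_trans _ _ (delta * 2 ^+ n)); last by rewrite ler_pM2l.
have -> : delta * 2 ^+ n = delta / 2 * 2 ^+ n + delta / 2 * 2 ^+ n by field.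
apply: le_trans (lerD low high); rewrite -natrD ler_nat.
apply: leq_trans (leq_card_setU _ _); apply/subset_leq_card/subsetP => A.
rewrite inE in_setU in_setD => /andP[-> fA]; rewrite [A \in [set _ in _ | _]]inE fA.
by case: (A \in sgs_high f D).
Qed.

Local Open Scope classical_set_scope.
Local Open Scope ring_scope.

(** * The average genus *)

Lemma card_fset_set_seq (T : choiceType) (r : seq T) :
  uniq r -> #|` fset_set [set` r]| = size r.
Proof.
move=> ur; apply: (@perm_size _ (enum_fset _) r).
apply: uniq_perm => //.
by move=> x; rewrite in_fset_set ?mem_setE //; exact: finite_seq.
Qed.

(** At [n = f] the default value of [nth] makes [f] a gap. *)
Definition untruncate f (A : f.-tuple bool) : set nat :=
  [set n | nth false A n || (f < n)%N].

Lemma untruncateE f (A : f.-tuple bool) n : (n < f)%N ->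
  untruncate A n = nth false A n :> Prop.
Proof. by move=> nf; rewrite /untruncate /= [(f < n)%N]ltnNge ltnW // orbF. Qed.

Lemma untruncate_inj f : injective (@untruncate f).
Proof.
move=> A B AB; apply/val_inj/(@eq_from_nth _ false) => [|i]; rewrite !size_tuple // => fi.
have : untruncate A i = untruncate B i by rewrite AB.
by rewrite !untruncateE // => /propeqP e; apply/idP/idP => /e.
Qed.

Lemma genus_untruncate f (A : f.-tuple bool) :
  genus (untruncate A) = (f.+1 - count id A)%N.
Proof.
have -> : genus (untruncate A) =
    #|` fset_set [set` rcons [seq n <- iota 0 f | ~~ nth false A n] f]|.
  congr (#|` fset_set _|); apply/seteqP; split => n; rewrite /= mem_rcons inE mem_filter mem_iota.
    move=> /negP; rewrite negb_or -leqNgt leq_eqVlt => /andP[-> /orP[->//|nf]].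
    by rewrite nf orbT.
  case/orP => [/eqP ->|/andP[nA /= nf]]; apply/negP; rewrite negb_or -leqNgt.
    by rewrite leqnn andbT nth_default ?size_tuple.
  by rewrite nA ltnW.
rewrite card_fset_set_seq; last first.
  by rewrite rcons_uniq filter_uniq ?iota_uniq // andbT mem_filter mem_iota add0n ltnn !andbF.
rewrite size_rcons size_filter.
have -> : count (fun n => ~~ nth false A n) (iota 0 f) = count negb A.
  by rewrite -[in RHS](mkseq_nth false A) size_tuple count_map.
have := count_predC id A; rewrite size_tuple (eq_count (_ : predC id =1 negb)) //.
by move: (count id A) (count negb A) => a b; lia.
Qed.

Lemma semigroups_of_frobeniusE f : (0 < f)%N ->
  semigroups_of_frobenius f = [set` [seq untruncate A | A <- enum (sgs f)]].
Proof.
move=> f0; apply/seteqP; split => [S [[S0 SD Sfin] [Sf ub]]|_ /mapP[A + ->]] /=.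
  pose A : f.-tuple bool := [tuple `[< S i >] | i < f].
  have AE n : (n < f)%N -> nth false A n = `[< S n >].
    by move=> nf; rewrite -[n in LHS]/(val (Ordinal nf)) -tnth_nth tnth_mktuple.
  have SA : S = untruncate A.
    apply/seteqP; split => n.
      move=> Sn; rewrite /untruncate /=; have [nf|fn] := ltnP n f.
        by rewrite AE //; apply/orP; left; apply/asboolP.
      rewrite orbC ltn_neqAle fn andbT; have [fn'|//] := eqVneq f n.
      by rewrite -fn' in Sn.
    rewrite /untruncate /= => /orP[An|fn].
      by move: (An); rewrite (AE _ (@nth_lt f A n An)) => /asboolP.
    by apply: contrapT => /ub; rewrite leqNgt fn.
  apply/mapP; exists A => //; rewrite mem_enum inE; apply/andP; split.
    by rewrite AE //; apply/asboolP.
  apply/forallP => x; apply/forallP => y; rewrite (AE x) // (AE y) //.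
  apply/implyP => /andP[/asboolP Sx /asboolP Sy].
  have Sxy := SD _ _ Sx Sy; apply/andP; split.
    by apply/eqP => e; rewrite e in Sxy.
  by apply/implyP => xy; rewrite AE //; apply/asboolP.
rewrite mem_enum inE => AS.
split; [split|split] => /=.
- by rewrite /untruncate /=; move: AS => /andP[->].
- move=> m n; rewrite /untruncate /= => hm hn.
  have [mn|fmn] := ltnP f (m + n)%N; first by rewrite orbT.
  have big k l : (k + l <= f)%N -> nth false A k || (f < k)%N -> nth false A k.
    by move=> kl /orP[//|fk]; exfalso; lia.
  have Am := big m n fmn hm; have An := big n m; rewrite addnC in An; have {}An := An fmn hn.
  have ne : (m + n)%N != f by apply/eqP => /(truncated_semigroupN AS Am An).
  by rewrite (truncated_semigroupD AS Am An) //; rewrite ltn_neqAle ne.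
- apply: (@sub_finite_set _ _ `I_f.+1); last exact: finite_II.
  by move=> n /negP; rewrite negb_or -leqNgt => /andP[_]; rewrite /= ltnS.
- by apply/negP; rewrite negb_or -leqNgt leqnn andbT nth_default ?size_tuple.
- by move=> n /negP; rewrite negb_or -leqNgt => /andP[_].
Qed.

Lemma average_genusE (R : realType) f : (0 < f)%N ->
  average_genus R f =
    #|sgs f|%:R^-1 * \sum_(A in sgs f) (f.+1 - count id A)%N%:R.
Proof.
move=> f0.
have u : uniq [seq untruncate A | A <- enum (sgs f)].
  by rewrite map_inj_uniq ?enum_uniq //; exact: untruncate_inj.
rewrite /average_genus /num_semigroups_of_frobenius semigroups_of_frobeniusE //.
rewrite card_fset_set_seq // size_map -cardE -fsbig_seq // big_map big_enum.
by congr (_ * _); apply: eq_bigr => A _; rewrite genus_untruncate.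
Qed.

(** If [A] is not far, its genus differs from [3f/4] by at most [(f %/ p) / 4 + 1], hence by at most
    [e * f / 2]. A far [A] deviates by at most [2 * f], and the far ones are a proportion of at most
    [e / 4]. *)
Lemma average_genus_dist (R : realType) (e : R) f p : (0 < f)%N -> (0 < p)%N ->
  p%:R^-1 <= e -> 4 <= e * f%:R ->
  #|[set A in sgs f | far (f %/ p) A]%SET|%:R <= e / 4 * #|sgs f|%:R ->
  `|average_genus R f - 3 * f%:R / 4| <= e * f%:R.
Proof.
move=> f0 p0 pe ef farN; rewrite average_genusE //; set N := #|sgs f|%:R in farN *.
have N0 : 0 < N :> R.
  by rewrite ltr0n; apply: leq_trans (card_sgs_ge f0); rewrite expn_gt0.
have F0 : 0 <= f%:R :> R by [].
have -> : N^-1 * (\sum_(A in sgs f) (f.+1 - count id A)%N%:R) - 3 * f%:R / 4 =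
    N^-1 * \sum_(A in sgs f) ((f.+1 - count id A)%N%:R - 3 * f%:R / 4) :> R.
  by rewrite sumrB sumr_const -[(_ / 4) *+ _]mulr_natl mulrBr mulKf // gt_eqF.
rewrite normrM ger0_norm ?invr_ge0 ?(ltW N0) // ler_pdivrMl //.
apply: le_trans (ler_norm_sum _ _ _) _.
apply: (@le_trans _ _ (\sum_(A in sgs f) (e / 2 * f%:R + (far (f %/ p) A)%:R * (2 * f%:R)))).
  apply: ler_sum => A _.
  have cf : (count id A <= f)%N by have := count_size id A; rewrite size_tuple.
  have f1 : 1 <= f%:R :> R by rewrite ler1n.
  have e0 : 0 <= e by apply: le_trans pe; rewrite invr_ge0.
  have c0 : 0 <= (count id A)%:R :> R by [].
  have cfR : (count id A)%:R <= f%:R :> R by rewrite ler_nat.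
  rewrite natrB ?leqW // -natr1.
  have [fA|nfA] := boolP (far _ A).
    by rewrite mul1r ler_norml; apply/andP; split; nra.
  have Ee : (f %/ p)%:R <= e * f%:R :> R.
    apply: (@le_trans _ _ (p%:R^-1 * f%:R)); last exact: ler_wpM2r.
    by rewrite mulrC ler_pdivlMr ?ltr0n // -natrM ler_nat leq_trunc_div.
  move: nfA; rewrite /far /= negb_or -!ltnNge -!(ltr_nat R) !(natrM, natrD) => /andP[h1 h2].
  rewrite mul0r addr0 ler_norml; apply/andP; split; lra.
rewrite big_split /= sumr_const -[(e / 2 * _) *+ _]mulr_natl -mulr_suml.
have -> : \sum_(A in sgs f) (far (f %/ p) A)%:R = #|[set A in sgs f | far (f %/ p) A]%SET|%:R :> R.
  rewrite -sum1_card natr_sum [RHS]big_mkcond [LHS]big_mkcond /=.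
  by apply: eq_bigr => A _; rewrite !inE; case: (truncated_semigroup A) (far _ A) => [] [].
have := ler_wpM2r F0 farN; rewrite -/N; nra.
Qed.

Theorem theorem1p2 (R : realType) :
  (fun f : nat => average_genus R f) =
    (fun f : nat => 3 * f%:R / 4) +o_ \oo (fun f : nat => f%:R : R).
Proof.
apply/eqaddoP => e e0.
(* With [1 / p <= e], the tolerance [f %/ p] in [far] is at most [e * f]. *)
pose p := Num.bound (e^-1).
have ep : e^-1 < p%:R by apply: archi_boundP; rewrite invr_ge0 ltW.
have p0 : (0 < p)%N by rewrite -(ltr0n R) (lt_trans _ ep) ?invr_gt0.
have pe : p%:R^-1 <= e by rewrite invf_ple ?posrE ?ltr0n // ltW.
have [N farN] := @card_far R p _ p0 (divr_gt0 e0 (ltr0n R 4)).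
near=> f.
have f0 : (0 < f)%N by near: f; exact: nbhs_infty_gt.
have Nf : (N <= f)%N by near: f; exact: nbhs_infty_ge.
have fe : 4 / e <= f%:R by near: f; exact: nbhs_infty_ger.
rewrite [X in _ <= _ * X]ger0_norm //.
apply: (@average_genus_dist R e f p f0 p0 pe) (farN f Nf).
by rewrite mulrC -ler_pdivrMr.
Unshelve. all: by end_near.
Qed.
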